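(* Let $\alpha_{mn}$ denote the infimum of the precision of the approximate solution over all $m$-dimensional integer knapsack problems in $n$ variables (as defined in the context), and let $\alpha_{1k}$ be the same quantity for one-dimensional problems in $k$ variables. If $n\to\infty$ and $m = m(n)$ is a positive integer depending on $n$ with $m = o(n)$, then $$\alpha_{mn} \sim \frac{\alpha_{1,\lfloor n/m\rfloor}}{m},$$ that is, the ratio of the two sides tends to $1$ as $n\to\infty$.
   Context: $\mathbb{Z}_+$ and $\mathbb{R}_+$ denote the sets of non-negative integers and non-negative reals. For $A = (a_{ij}) \in \mathbb{R}_+^{m\times n}$, $b = (b_i) \in \mathbb{R}_+^m$, put $L(A,b) = \{x \in \mathbb{Z}_+^n : Ax \le b\}$. For $c = (c_j)\in\mathbb{R}_+^n$, the integer $m$-dimensional knapsack problem is to maximize $cx = \sum_j c_j x_j$ over $x \in L(A,b)$. For $j = 1,\dots,n$ let $v^{(j)} \in L(A,b)$ be the point all of whose coordinates are $0$ except the $j$-th, which equals $v^{(j)}_j = \min_{i:\, a_{ij}>0} \lfloor b_i/a_{ij} \rfloor$. Let $V(A,b) = \{v^{(1)},\dots,v^{(n)}\}$. A point of $V(A,b)$ maximizing $cx$ over $V(A,b)$ is called an approximate solution, and the precision of the approximate solution is $$\alpha(A,b,c) = \frac{\max_{x\in V(A,b)} cx}{\max_{x\in L(A,b)} cx}.$$ Only instances for which this is well defined are considered: every column of $A$ has a positive entry (so $L(A,b)$ is finite) and $\max_{x\in L(A,b)} cx > 0$. Define $$\alpha_{mn} = \inf\{\alpha(A,b,c) : A\in\mathbb{R}_+^{m\times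 n},\ b\in\mathbb{R}_+^m,\ c\in\mathbb{R}_+^n\},$$ the infimum being over such instances. It is known from earlier literature that for $m=1$, $\alpha_{1n} = \delta_n/\varepsilon_n$ for $n\ge 1$, where $\delta_1=\varepsilon_1=1$, $\delta_n = \delta_{n-1}(\delta_{n-1}+1)$, $\varepsilon_n = 1 + \varepsilon_{n-1}(\delta_{n-1}+1)$. *)

(* Defs.v *)
From mathcomp Require Import all_boot all_order all_algebra.
From mathcomp Require Import all_classical all_reals all_analysis.

Set Implicit Arguments.
Unset Strict Implicit.
Unset Printing Implicit Defensive.

Import Order.TTheory GRing.Theory Num.Theory.
Import numFieldNormedType.Exports.

Local Open Scope classical_set_scope.
Local Open Scope ring_scope.

Section Knapsack.
Variable R : realType.

(* Points of Z_+^n are columns of natural numbers, embedded entrywise in R^n. *)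
Definition realpt (n : nat) (x : 'cV[nat]_n) : 'cV[R]_n :=
  map_mx (fun k => k%:R) x.

Definition objective (n : nat) (c : 'rV[R]_n) (x : 'cV[nat]_n) : R :=
  (c *m realpt x) 0 0.

Definition feasible (m n : nat) (A : 'M[R]_(m, n)) (b : 'cV[R]_m) :
    set 'cV[nat]_n :=
  [set x | forall i, (A *m realpt x) i 0 <= b i 0].

(* The minimum of floor (b_i / a_ij) over the rows i with a_ij > 0.  The
   starting value of the iterated minn is the maximum over the same rows, so
   it has no effect as soon as column j has a positive entry.  The quotients
   are nonnegative, hence truncn is the floor. *)
Definition axis_bound (m n : nat) (A : 'M[R]_(m, n)) (b : 'cV[R]_m)
    (j : 'I_n) : nat :=
  let f i := Num.truncn (b i 0 / A i j) in
  (\big[minn / \max_(i < m | (0 < A i j)%R) f i]_(i < m | (0 < A i j)%R)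
     f i)%N.

Definition axis_point (m n : nat) (A : 'M[R]_(m, n)) (b : 'cV[R]_m)
    (j : 'I_n) : 'cV[nat]_n :=
  \col_k (if k == j then axis_bound A b j else 0%N).

Definition axis_points (m n : nat) (A : 'M[R]_(m, n)) (b : 'cV[R]_m) :
    set 'cV[nat]_n :=
  range (axis_point A b).

(* Only used on finite nonempty sets of points (see well_defined), where the
   supremum is a maximum. *)
Definition maxval (n : nat) (c : 'rV[R]_n) (X : set 'cV[nat]_n) : R :=
  sup (objective c @` X).

Definition precision (m n : nat) (A : 'M[R]_(m, n)) (b : 'cV[R]_m)
    (c : 'rV[R]_n) : R :=
  maxval c (axis_points A b) / maxval c (feasible A b).

(* The fourth condition makes [feasible A b] finite; the last one excludes a
   zero denominator in [precision] (and forces 0 < n). *)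
Definition well_defined (m n : nat) (A : 'M[R]_(m, n)) (b : 'cV[R]_m)
    (c : 'rV[R]_n) : Prop :=
  [/\ forall i j, 0 <= A i j,
      forall i, 0 <= b i 0,
      forall j, 0 <= c 0 j,
      forall j, exists i, 0 < A i j &
      0 < maxval c (feasible A b)].

Definition alpha (m n : nat) : R :=
  inf [set r | exists (A : 'M[R]_(m, n)) (b : 'cV[R]_m) (c : 'rV[R]_n),
                 well_defined A b c /\ r = precision A b c].

End Knapsack.

(* Main.v *)
(* One has alpha_{1,n} / m <= alpha_{m,n} <= alpha_{1,k} / m for k = n %/ m:
   on the left, the columns of an instance are grouped by a row limiting them,
   and on the right, m copies of a one-dimensional instance are put together.
   For m = 1 the right-hand bound says that alpha_{1,k} is nonincreasing in k;
   it is at least 1/2, hence has a positive limit, and both outer terms are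
   equivalent as n / m tends to infinity.  The values delta_n / epsilon_n of
   alpha_{1,n} play no role. *)
Require Import Defs.
From mathcomp Require Import all_boot all_order all_algebra.
From mathcomp Require Import all_classical all_reals all_analysis.

Set Implicit Arguments.
Unset Strict Implicit.
Unset Printing Implicit Defensive.

Import Order.TTheory GRing.Theory Num.Theory.
Import numFieldNormedType.Exports.

Local Open Scope classical_set_scope.
Local Open Scope ring_scope.

(** * Feasible points, axis points and optima of a single instance *)

Section Instances.
Variables (R : realType) (m n : nat).
Implicit Types (A : 'M[R]_(m, n)) (b : 'cV[R]_m) (c : 'rV[R]_n).

(** The positivity of the optimum is split off from [well_defined], because the one-row instances
    built later from groups of columns may have optimum 0. *)
Definition admissible A b c : Prop :=
  [/\ forall i j, 0 <= A i j,
      forall i, 0 <= b i 0,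
      forall j, 0 <= c 0 j &
      forall j, exists i, 0 < A i j].

Lemma objectiveE c x : objective c x = \sum_j c 0 j * (x j 0)%:R.
Proof. by rewrite /objective mxE; apply: eq_bigr => j _; rewrite mxE. Qed.

Lemma feasibleP A b x :
  feasible A b x <-> forall i, \sum_j A i j * (x j 0)%:R <= b i 0.
Proof.
have E i : (A *m realpt R x) i 0 = \sum_j A i j * (x j 0)%:R.
  by rewrite mxE; apply: eq_bigr => j _; rewrite mxE.
by split=> h i; have := h i; rewrite E.
Qed.

(** At [N = axis_bound A b j] this is convertible to [axis_point A b j], so facts about [axis] apply
    to axis points directly. *)
Definition axis (j : 'I_n) (N : nat) : 'cV[nat]_n :=
  \col_k (if k == j then N else 0%N).

Lemma sum_axis (F : 'I_n -> R) j N :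
  \sum_k F k * (axis j N k 0)%:R = F j * N%:R.
Proof.
rewrite (bigD1 j) //= mxE eqxx big1 ?addr0 // => k /negPf kj.
by rewrite mxE kj mulr0.
Qed.

Lemma objective_axis c j N : objective c (axis j N) = c 0 j * N%:R.
Proof. by rewrite objectiveE sum_axis. Qed.

Lemma feasible_axis A b j N :
  feasible A b (axis j N) <-> forall i, A i j * N%:R <= b i 0.
Proof. by rewrite feasibleP; split=> + i => /(_ i); rewrite sum_axis. Qed.

Lemma bigminn_le_cond (I : eqType) (r : seq I) (P : pred I) (F : I -> nat) z i :
  i \in r -> P i -> (\big[minn/z]_(k <- r | P k) F k <= F i)%N.
Proof.
elim: r => // k r IH; rewrite inE big_cons => /orP[/eqP <- ->|ir Pi].
  exact: geq_minl.
by case: ifP => _; rewrite ?geq_min IH ?orbT.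
Qed.

Lemma feasible_axis_point A b c j :
  admissible A b c -> feasible A b (axis_point A b j).
Proof.
move=> [A0 b0 _ _]; apply/feasible_axis => i.
have [Aij|Aij] := ltrP 0 (A i j); last first.
  have /eqP -> : A i j == 0 by rewrite eq_le Aij A0.
  by rewrite mul0r.
rewrite mulrC -ler_pdivlMr // -truncn_ge_nat ?divr_ge0 //.
exact: bigminn_le_cond (mem_index_enum i) Aij.
Qed.

(** A row with the smallest quotient caps the axis by itself; this is what reduces [m] constraints
    to one. *)
Lemma axis_bound_witness A b c j : admissible A b c ->
  exists i, 0 < A i j /\
    forall N, A i j * N%:R <= b i 0 -> (N <= axis_bound A b j)%N.
Proof.
move=> [A0 b0 _ /(_ j) [i0 Ai0]].
pose f i := Num.truncn (b i 0 / A i j).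
case: (@arg_minnP _ i0 (fun i => 0 < A i j) f Ai0) => i Ai fmin.
exists i; split=> // N.
rewrite mulrC -ler_pdivlMr // -truncn_ge_nat ?divr_ge0 // => /leq_trans; apply.
(* The starting value of the iterated minimum is a maximum over rows including [i], so it is at
   least [f i] as well. *)
rewrite /axis_bound; apply: (big_ind (fun z => (f i <= z)%N)) => //.
- exact: (@leq_bigmax_cond _ (fun i => 0 < A i j) f i Ai).
- by move=> x y; rewrite leq_min => -> ->.
Qed.

Lemma feasible_le_axis_bound A b c x j :
  admissible A b c -> feasible A b x -> (x j 0%R <= axis_bound A b j)%N.
Proof.
move=> inst /feasibleP feas; have [i [_ ->]] := axis_bound_witness j inst => //.
case: inst => A0 _ _ _; apply: le_trans (feas i); rewrite (bigD1 j) //= lerDl.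
by apply: sumr_ge0 => k _; rewrite mulr_ge0.
Qed.

Lemma has_ubound_feasible A b c :
  admissible A b c -> has_ubound (objective c @` feasible A b).
Proof.
move=> inst; exists (\sum_j c 0 j * (axis_bound A b j)%:R) => _ [x feas <-].
rewrite objectiveE; apply: ler_sum => j _; case: (inst) => _ _ c0 _.
by rewrite ler_wpM2l // ler_nat (feasible_le_axis_bound j inst).
Qed.

Lemma le_maxval_feasible A b c x : admissible A b c -> feasible A b x ->
  objective c x <= maxval c (feasible A b).
Proof.
by move=> /has_ubound_feasible/ub_le_sup + feas; apply; exists x.
Qed.

Lemma feasible0 A b c : admissible A b c -> feasible A b 0.
Proof.
case=> _ b0 _ _; apply/feasibleP => i.
by rewrite big1 // => j _; rewrite mxE mulr0.
Qed.

Lemma maxval_feasible_le A b c B : admissible A b c ->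
  (forall x, feasible A b x -> objective c x <= B) ->
  maxval c (feasible A b) <= B.
Proof.
move=> /feasible0 f0 leB; apply: ge_sup; first by exists (objective c 0), 0.
by move=> _ [x feas <-]; exact: leB.
Qed.

Lemma le_maxval_axis A b c j : admissible A b c ->
  c 0 j * (axis_bound A b j)%:R <= maxval c (axis_points A b).
Proof.
move=> inst; rewrite -objective_axis; apply: ub_le_sup; last first.
  by exists (axis_point A b j) => //; exists j.
have [B ubB] := has_ubound_feasible inst; exists B => _ [_ [k _ <-] <-].
by apply: ubB; exists (axis_point A b k) => //; apply: feasible_axis_point inst.
Qed.

Lemma maxval_axis_le A b c B : (0 < n)%N ->
  (forall j, c 0 j * (axis_bound A b j)%:R <= B) ->
  maxval c (axis_points A b) <= B.
Proof.
move=> n0 leB; apply: ge_sup.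
  pose v := axis_point A b (Ordinal n0).
  by exists (objective c v), v => //; exists (Ordinal n0).
by move=> _ [_ [j _ <-] <-]; rewrite objective_axis.
Qed.

Lemma maxval_axis_ge0 A b c : (0 < n)%N -> admissible A b c ->
  0 <= maxval c (axis_points A b).
Proof.
move=> n0 inst; apply: le_trans (le_maxval_axis (Ordinal n0) inst).
by case: inst => _ _ c0 _; rewrite mulr_ge0.
Qed.

Lemma well_definedP A b c :
  well_defined A b c <-> admissible A b c /\ 0 < maxval c (feasible A b).
Proof. by split=> [[*]|[[*]]]. Qed.

Lemma alpha_le_precision A b c : (0 < n)%N -> well_defined A b c ->
  alpha R m n <= precision A b c.
Proof.
move=> n0 wd; apply: ge_inf; last by exists A, b, c.
exists 0 => _ [A' [b' [c' [/well_definedP[inst pos] ->]]]].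
by rewrite divr_ge0 ?maxval_axis_ge0 // ltW.
Qed.

(** Product form of [alpha_le_precision] that also covers a zero optimum, where the left side
    vanishes. *)
Lemma alpha_mul_maxval_le A b c : (0 < n)%N -> admissible A b c ->
  alpha R m n * maxval c (feasible A b) <= maxval c (axis_points A b).
Proof.
move=> n0 inst; have Mge0 : 0 <= maxval c (feasible A b).
  apply: le_trans (le_maxval_feasible inst (feasible0 inst)).
  by rewrite objectiveE big1 // => j _; rewrite mxE mulr0.
move: (Mge0); rewrite le_eqVlt => /predU1P[<-|pos].
  by rewrite mulr0 maxval_axis_ge0.
by rewrite -ler_pdivlMr //; apply: alpha_le_precision => //; apply/well_definedP.
Qed.

Lemma le_alpha B : (0 < m)%N -> (0 < n)%N ->
  (forall A b c, well_defined A b c -> B <= precision A b c) -> B <= alpha R m n.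
Proof.
move=> m0 n0 leB; apply: lb_le_inf; last first.
  by move=> _ [A [b [c [wd ->]]]]; exact: leB.
(* The infimum must range over a nonempty set; in the all-ones instance a unit vector is feasible
   and has value 1. *)
pose A : 'M[R]_(m, n) := const_mx 1; pose b : 'cV[R]_m := const_mx 1.
pose c : 'rV[R]_n := const_mx 1.
exists (precision A b c), A, b, c; split=> //.
have inst : admissible A b c.
  by split=> [i j|i|j|j]; rewrite ?mxE //; exists (Ordinal m0); rewrite mxE.
apply/well_definedP; split=> //.
have feas : feasible A b (axis (Ordinal n0) 1).
  by apply/feasible_axis => i; rewrite !mxE mulr1.
apply: lt_le_trans (le_maxval_feasible inst feas).
by rewrite objective_axis mxE mulr1.
Qed.

End Instances.

(** * Comparison of [alpha R m n] with one-dimensional problems *)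

Section Bounds.
Variable R : realType.

(* Every variable used by a feasible point has axis bound [v >= 1], so that
   [b < a * (v + 1) <= 2 * a * v]. *)
Lemma alpha1_ge_half k : (0 < k)%N -> 2^-1 <= alpha R 1 k.
Proof.
move=> k0; apply: le_alpha => // A b c /well_definedP[inst pos].
rewrite /precision ler_pdivlMr // mulrC ler_pdivrMr // mulrC.
apply: maxval_feasible_le (inst) _ => x feas.
set M := maxval _ _; have M0 : 0 <= M by exact: maxval_axis_ge0.
have [A0 b0 c0 _] := inst.
(* Division-free form of c_j / a_j <= 2M / b, to be summed over [j] against the constraint. *)
have lejM j : b 0 0 * (c 0 j * (x j 0)%:R) <= 2 * M * (A 0 j * (x j 0)%:R).
  have [->|xj] := posnP (x j 0); first by rewrite !mulr0.
  have v0 := leq_trans xj (feasible_le_axis_bound j inst feas).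
  rewrite !mulrA ler_wpM2r //.
  have bv : b 0 0 <= 2 * (A 0 j * (axis_bound A b j)%:R).
    have [i [_ wit]] := axis_bound_witness j inst.
    rewrite ord1 in wit; apply: contraT; rewrite -ltNge => vb.
    have : ((axis_bound A b j).*2 <= axis_bound A b j)%N.
      apply: wit; rewrite -mul2n natrM mulrCA; exact: ltW.
    by rewrite -addnn -[leqRHS]addn0 leq_add2l leqNgt v0.
  apply: le_trans (ler_wpM2r (c0 j) bv) _.
  rewrite -!mulrA ler_wpM2l // [M * _]mulrC ler_wpM2l // [_ * c 0 j]mulrC.
  exact: le_maxval_axis.
have : b 0 0 * objective c x <= 2 * M * b 0 0.
  rewrite objectiveE mulr_sumr; apply: le_trans (ler_sum _ (fun j _ => lejM j)) _.
  by rewrite -mulr_sumr ler_wpM2l ?mulr_ge0 //; move/feasibleP: feas.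
have [bpos|b_eq0] := ltrP 0 (b 0 0).
  by rewrite [_ * b 0 0]mulrC ler_pM2l.
(* With a zero right-hand side [b 0 0] cannot be cancelled, but all coefficients of the row are
   positive, which forces [x] to vanish. *)
move=> _; rewrite objectiveE big1 ?mulr_ge0 // => j _.
suff -> : x j 0 = 0%N by rewrite mulr0.
have [i [Aij _]] := axis_bound_witness j inst; rewrite ord1 in Aij.
move/feasibleP: feas => /(_ 0) /le_trans /(_ b_eq0).
rewrite (bigD1 j) //= => sum_le0; apply/eqP.
rewrite -(eqr_nat R) eq_le ler0n andbT -(pmulr_rle0 _ Aij).
apply: le_trans sum_le0; rewrite lerDl.
by apply: sumr_ge0 => l _; rewrite mulr_ge0.
Qed.

(* Group the columns by a row attaining the minimum in [axis_bound]: on each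
   group that single row gives a one-dimensional problem with the same axis
   points. *)
Lemma alpha1_le_alpha m n : (0 < m)%N -> (0 < n)%N ->
  alpha R 1 n <= alpha R m n * m%:R.
Proof.
move=> m0 n0; have mR : 0 < m%:R :> R by rewrite ltr0n.
rewrite -ler_pdivrMr //; apply: le_alpha => // A b c /well_definedP[inst pos].
rewrite /precision ler_pdivlMr // mulrAC ler_pdivrMr //.
have a0 : 0 < alpha R 1 n.
  by apply: lt_le_trans (alpha1_ge_half n0); rewrite invr_gt0.
rewrite mulrC -ler_pdivlMr //; apply: maxval_feasible_le (inst) _ => x feas.
rewrite ler_pdivlMr //.
have [h hP] := choice (fun j => axis_bound_witness j inst).
have [A0 b0 c0 _] := inst.
set M := maxval _ _.
(* Columns outside the group get entry 1 to stay admissible and value 0 to contribute nothing. *)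
pose Ai i : 'M[R]_(1, n) := \row_j (if h j == i then A i j else 1).
pose bi i : 'cV[R]_1 := const_mx (b i 0).
pose ci i : 'rV[R]_n := \row_j (if h j == i then c 0 j else 0).
pose xi i : 'cV[nat]_n := \col_j (if h j == i then x j 0 else 0%N).
have insti i : admissible (Ai i) (bi i) (ci i).
  split=> [i' j|i'|j|j]; rewrite ?mxE //; try by case: ifP.
  by exists 0; rewrite mxE; case: eqP => // <-; case: (hP j).
have feasi i : feasible (Ai i) (bi i) (xi i).
  apply/feasibleP => i'; rewrite mxE; move/feasibleP: feas => /(_ i).
  apply: le_trans; apply: ler_sum => j _; rewrite !mxE.
  by case: ifP => // _; rewrite mulr0 mulr_ge0.
have leM i : objective (ci i) (xi i) * alpha R 1 n <= M.
  apply: le_trans (ler_wpM2r (ltW a0) (le_maxval_feasible (insti i) (feasi i))) _.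
  rewrite mulrC; apply: le_trans (alpha_mul_maxval_le n0 (insti i)) _.
  apply: maxval_axis_le => // j; rewrite mxE; case: eqP => [hj|_]; last first.
    by rewrite mul0r maxval_axis_ge0.
  apply: le_trans (le_maxval_axis j inst).
  (* Row [h j] alone caps axis [j] of [A], so the one-row instance allows no longer axis point. *)
  rewrite ler_wpM2l // ler_nat; apply: (hP j).2; rewrite hj.
  have /feasible_axis/(_ 0) := feasible_axis_point j (insti i).
  by rewrite !mxE hj eqxx.
have -> : objective c x = \sum_i objective (ci i) (xi i).
  under eq_bigr do rewrite objectiveE.
  rewrite exchange_big objectiveE; apply: eq_bigr => j _ /=.
  rewrite (bigD1 (h j)) //= big1 => [|i]; first by rewrite !mxE eqxx addr0.
  by rewrite eq_sym !mxE => /negPf ->; rewrite mul0r.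
rewrite mulr_suml; apply: le_trans (ler_sum _ (fun i _ => leM i)) _.
by rewrite sumr_const card_ord mulr_natr.
Qed.

(** Euclidean division by [k] identifies the indices below [m * k] with pairs of a block and a
    position in it. *)
Lemma sum_blocks m k n (G : nat -> nat -> R) : (0 < k)%N -> (m * k <= n)%N ->
  \sum_(j < n) (if (j < m * k)%N then G (j %/ k)%N (j %% k)%N else 0) =
  \sum_(i < m) \sum_(r < k) G i r.
Proof.
move=> k0 mkn; rewrite -big_mkcond.
rewrite -(big_ord_widen n (fun j => G (j %/ k)%N (j %% k)%N) mkn).
rewrite -(big_mkord xpredT (fun j => G (j %/ k)%N (j %% k)%N)).
rewrite big_nat_mul big_mkord; apply: eq_bigr => i _.
rewrite -{1}[(i * k)%N]add0n big_addn mulSn addnK big_mkord.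
apply: eq_bigr => r _.
by rewrite addnC divnMDl // modnMDl divn_small ?modn_small ?addn0.
Qed.

(* Block-diagonal instance: [m] disjoint copies of a one-dimensional problem,
   the leftover columns having no value. *)
Lemma alpha_le_alpha1 m n k : (0 < m)%N -> (0 < k)%N -> (m * k <= n)%N ->
  alpha R m n * m%:R <= alpha R 1 k.
Proof.
(* The block length becomes [k.+1], the form in which [inord] yields positions. *)
move=> m0; case: k => // k _ mkn.
have n0 : (0 < n)%N by apply: leq_trans mkn; rewrite muln_gt0 m0.
have mR : 0 < m%:R :> R by rewrite ltr0n.
apply: le_alpha => // a b c /well_definedP[inst pos].
have [a0 b0 c0 apos] := inst.
pose A : 'M[R]_(m, n) := \matrix_(i, j)
  if (j < m * k.+1)%N then
    if (j %/ k.+1 == i)%N then a 0 (inord (j %% k.+1)) else 0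
  else 1.
pose B : 'cV[R]_m := const_mx (b 0 0).
pose C : 'rV[R]_n :=
  \row_j if (j < m * k.+1)%N then c 0 (inord (j %% k.+1)) else 0.
have instA : admissible A B C.
  split=> [i j|i|j|j]; rewrite ?mxE //.
  - by case: ifP => // _; case: ifP.
  - by case: ifP.
  have [jm|jm] := ltnP j (m * k.+1); last first.
    by exists (Ordinal m0); rewrite mxE ltnNge jm.
  rewrite -ltn_divLR // in jm; exists (Ordinal jm); rewrite mxE /=.
  rewrite -ltn_divLR // jm eqxx.
  by have [i] := apos (inord (j %% k.+1)); rewrite ord1.
have lower : maxval c (feasible a b) * m%:R <= maxval C (feasible A B).
  rewrite -ler_pdivlMr //; apply: maxval_feasible_le (inst) _ => x feas.
  rewrite ler_pdivlMr //.
  (* Repeating [x] in every block multiplies its value by [m], while each row sees only one copy. *)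
  pose y : 'cV[nat]_n :=
    \col_j if (j < m * k.+1)%N then x (inord (j %% k.+1)) 0 else 0%N.
  have -> : objective c x * m%:R = objective C y.
    pose G (_ r : nat) := c 0 (inord r) * (x (inord r) 0)%:R.
    rewrite !objectiveE; transitivity (\sum_(j < n) if (j < m * k.+1)%N then
      G (j %/ k.+1)%N (j %% k.+1)%N else 0); last first.
      by apply: eq_bigr => j _; rewrite !mxE; case: ifP; rewrite ?mul0r.
    rewrite sum_blocks // /G sumr_const card_ord mulr_natr.
    by congr (_ *+ _); apply: eq_bigr => r _; rewrite inord_val.
  apply: le_maxval_feasible => //; apply/feasibleP => i; rewrite mxE.
  move/feasibleP: feas => /(_ 0); apply: le_trans.
  pose G (l r : nat) :=
    (if l == i then a 0 (inord r) else 0) * (x (inord r) 0)%:R.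
  rewrite le_eqVlt; apply/orP; left; apply/eqP; transitivity (\sum_(j < n)
    if (j < m * k.+1)%N then G (j %/ k.+1)%N (j %% k.+1)%N else 0).
    by apply: eq_bigr => j _; rewrite !mxE; case: ifP; rewrite ?mulr0.
  rewrite sum_blocks // (bigD1 i) //= [X in _ + X]big1 => [|l].
    by rewrite addr0; apply: eq_bigr => r _; rewrite /G eqxx inord_val.
  rewrite -val_eqE /= => /negPf li.
  by rewrite big1 // => r _; rewrite /G li mul0r.
have upper : maxval C (axis_points A B) <= maxval c (axis_points a b).
  apply: maxval_axis_le => // j; rewrite mxE; case: ifP => [jm|_]; last first.
    by rewrite mul0r maxval_axis_ge0.
  set r := inord _; apply: le_trans (le_maxval_axis r inst).
  rewrite ler_wpM2l // ler_nat.
  have := jm; rewrite -ltn_divLR // => im.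
  have /feasible_axis/(_ (Ordinal im)) := feasible_axis_point j instA.
  rewrite !mxE jm /= eqxx -/r => le_b.
  have [i [_ wit]] := axis_bound_witness r inst.
  by rewrite ord1 in wit; exact: wit.
have posA : 0 < maxval C (feasible A B).
  by apply: lt_le_trans lower; rewrite mulr_gt0.
rewrite /precision ler_pdivlMr //; apply: le_trans upper.
apply: le_trans (alpha_mul_maxval_le n0 instA).
(* Positivity comes from the opposite bound [alpha1_le_alpha], and allows cancelling this factor to
   conclude from [lower]. *)
have alpha_gt0 : 0 < alpha R m n.
  rewrite -(pmulr_lgt0 _ mR); apply: lt_le_trans (alpha1_le_alpha m0 n0).
  by apply: lt_le_trans (alpha1_ge_half n0); rewrite invr_gt0.
by rewrite -mulrA ler_pM2l // mulrC.
Qed.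

Lemma alpha1_cvg : exists2 l : R, 0 < l & alpha R 1 k @[k --> \oo] --> l.
Proof.
have hl k : 2^-1 <= alpha R 1 k.+1 by exact: alpha1_ge_half.
(* The shift skips index 0, for which no well-defined instance exists. *)
have cv : cvgn (fun k => alpha R 1 k.+1).
  apply: nonincreasing_is_cvgn => [k n kn|]; last by exists 2^-1 => _ [k _ <-].
  by have := @alpha_le_alpha1 1 n.+1 k.+1; rewrite mulr1 mul1n; exact.
exists (limn (fun k => alpha R 1 k.+1)); last by rewrite -cvg_shiftS.
apply: lt_le_trans (limr_ge cv _); last by apply: nearW => k; exact: hl.
by rewrite invr_gt0.
Qed.

End Bounds.

(** * Asymptotics for [m = o(n)] *)

Lemma divn_cvgy (R : realType) (m : nat -> nat) (m_gt0 : forall n, (0 < m n)%N)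
    (m_small : (fun n => (m n)%:R : R) =o_\oo (fun n => n%:R : R)) :
  (n %/ m n)%N @[n --> \oo] --> \oo.
Proof.
apply/cvgnyPge => N.
(* Using [N.+1] rather than [N] keeps the constant positive at [N = 0]. *)
move/eqoP: m_small => /(_ N.+1%:R^-1); rewrite invr_gt0 ltr0n => /(_ isT).
apply: filterS => n; rewrite !normr_nat mulrC ler_pdivlMr ?ltr0n //.
rewrite -natrM ler_nat => le_n; rewrite leq_divRL //.
by apply: leq_trans le_n; rewrite mulnC leq_mul2l leqnSn orbT.
Qed.

Theorem corollary2 (R : realType) (m : nat -> nat)
    (m_gt0 : forall n, (0 < m n)%N)
    (m_small : (fun n => (m n)%:R : R) =o_\oo (fun n => n%:R : R)) :
  alpha R (m n) n / (alpha R 1 (n %/ m n) / (m n)%:R) @[n --> \oo] --> (1 : R).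
Proof.
have [l l0 cvl] := alpha1_cvg R.
have cvk := divn_cvgy m_gt0 m_small.
have cvq := cvg_comp _ _ cvk cvl.
have cvr : alpha R 1 n / alpha R 1 (n %/ m n) @[n --> \oo] --> (1 : R).
  rewrite -(divff (lt0r_neq0 l0)); apply: cvgM => //.
  by apply: cvgV => //; rewrite gt_eqF.
(* Both bounds on the ratio apply once [n %/ m n] is at least 1, which holds eventually. *)
apply: (squeeze_cvgr _ cvr (cvg_cst (1 : R))); move/cvgnyPge: cvk => /(_ 1%N).
apply: filterS => n k0.
have n0 : (0 < n)%N by apply: leq_trans k0 (leq_div _ _).
have a0 : 0 < alpha R 1 (n %/ m n).
  by apply: lt_le_trans (alpha1_ge_half R k0); rewrite invr_gt0.
rewrite invf_div mulrA; apply/andP; split.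
  by rewrite ler_pM2r ?invr_gt0 // alpha1_le_alpha.
by rewrite ler_pdivrMr // mul1r alpha_le_alpha1 // mulnC leq_divM.
Qed.
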